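(* Let $f(q)=\sum_{n=0}^{+\infty}q^{n}a_n$ be a slice regular function on $\mathbb{B}$ (with $a_n\in\mathbb{H}$) such that $f(q)\in\Pi:=\{q\in\mathbb{H}:\mathrm{Re}\,q\leq1\}$ for all $q\in\mathbb{B}$. Then $$\sum_{n=1}^{+\infty}|q^{n}a_n|\leq\mathrm{dist}\,(f(0),\partial\Pi),\qquad|q|\leq\frac13.$$
   Context: $\mathbb{H}$ denotes the quaternions, $\mathbb{B}=\{q\in\mathbb{H}:|q|<1\}$, $\mathbb{S}=\{q\in\mathbb{H}:q^2=-1\}$; for $I\in\mathbb{S}$, $\mathbb{C}_I=\mathbb{R}\oplus I\mathbb{R}$ and $\mathbb{B}_I=\mathbb{B}\cap\mathbb{C}_I$. A function $f:\mathbb{B}\to\mathbb{H}$ is (left) slice regular if for every $I\in\mathbb{S}$ the restriction $f_I=f|_{\mathbb{B}_I}$ has continuous partial derivatives and $\frac12\left(\frac{\partial}{\partial x}+I\frac{\partial}{\partial y}\right)f_I(x+yI)=0$ on $\mathbb{B}_I$; equivalently $f(q)=\sum_{n\ge0}q^na_n$ on $\mathbb{B}$ with $a_n\in\mathbb{H}$. $\mathrm{dist}$ is the Euclidean distance in $\mathbb{H}\cong\mathbb{R}^4$. *)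

(* Defs.v *)
From HB Require Import structures.
From mathcomp Require Import all_boot all_order all_algebra.
From mathcomp Require Import all_classical all_reals all_analysis.
From mathcomp Require Import ring lra.

Set Implicit Arguments.
Unset Strict Implicit.
Unset Printing Implicit Defensive.

Import Order.TTheory GRing.Theory Num.Theory.
Import numFieldNormedType.Exports.

Local Open Scope classical_set_scope.
Local Open Scope ring_scope.

(* Quat a b c d stands for a + b i + c j + d k. *)
Record quat (R : realType) := Quat { qre : R; qi : R; qj : R; qk : R }.

Section quaternions.
Context (R : realType).
Implicit Types (x y z : quat R) (t : R).

Lemma quatP x y : qre x = qre y -> qi x = qi y -> qj x = qj y -> qk x = qk y ->
  x = y.
Proof. by case: x y => [a b c d] [a' b' c' d'] /= -> -> -> ->. Qed.

Definition quat_tuple x : R * R * R * R := (qre x, qi x, qj x, qk x).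
Definition tuple_quat (p : R * R * R * R) : quat R :=
  Quat p.1.1.1 p.1.1.2 p.1.2 p.2.
Lemma quat_tupleK : cancel quat_tuple tuple_quat. Proof. by case. Qed.

HB.instance Definition _ := Choice.copy (quat R) (can_type quat_tupleK).

Definition quat_opp x := Quat (- qre x) (- qi x) (- qj x) (- qk x).
Definition quat_add x y :=
  Quat (qre x + qre y) (qi x + qi y) (qj x + qj y) (qk x + qk y).
Definition quat_mul x y :=
  Quat (qre x * qre y - qi x * qi y - qj x * qj y - qk x * qk y)
       (qre x * qi y + qi x * qre y + qj x * qk y - qk x * qj y)
       (qre x * qj y - qi x * qk y + qj x * qre y + qk x * qi y)
       (qre x * qk y + qi x * qj y - qj x * qi y + qk x * qre y).
Definition quat_scale t x := Quat (t * qre x) (t * qi x) (t * qj x) (t * qk x).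

Lemma quat_addA : associative quat_add.
Proof. by move=> x y z; apply: quatP => /=; ring. Qed.
Lemma quat_addC : commutative quat_add.
Proof. by move=> x y; apply: quatP => /=; ring. Qed.
Lemma quat_add0 : left_id (Quat 0 0 0 0) quat_add.
Proof. by move=> x; apply: quatP => /=; ring. Qed.
Lemma quat_addN : left_inverse (Quat 0 0 0 0) quat_opp quat_add.
Proof. by move=> x; apply: quatP => /=; ring. Qed.

HB.instance Definition _ :=
  GRing.isZmodule.Build (quat R) quat_addA quat_addC quat_add0 quat_addN.

Lemma quat_mulA : associative quat_mul.
Proof. by move=> x y z; apply: quatP => /=; ring. Qed.
Lemma quat_mul1l : left_id (Quat 1 0 0 0) quat_mul.
Proof. by move=> x; apply: quatP => /=; ring. Qed.
Lemma quat_mul1r : right_id (Quat 1 0 0 0) quat_mul.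
Proof. by move=> x; apply: quatP => /=; ring. Qed.
Lemma quat_mulDl : left_distributive quat_mul quat_add.
Proof. by move=> x y z; apply: quatP => /=; ring. Qed.
Lemma quat_mulDr : right_distributive quat_mul quat_add.
Proof. by move=> x y z; apply: quatP => /=; ring. Qed.
Lemma quat_1_neq0 : Quat 1 0 0 0 != 0 :> quat R.
Proof. by apply/eqP => -[/eqP]; rewrite oner_eq0. Qed.

HB.instance Definition _ := GRing.Zmodule_isNzRing.Build (quat R)
  quat_mulA quat_mul1l quat_mul1r quat_mulDl quat_mulDr quat_1_neq0.

Lemma quat_scaleA s t x : quat_scale s (quat_scale t x) = quat_scale (s * t) x.
Proof. by apply: quatP => /=; ring. Qed.
Lemma quat_scale1 : left_id 1 quat_scale.
Proof. by move=> x; apply: quatP => /=; ring. Qed.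
Lemma quat_scaleDr : right_distributive quat_scale +%R.
Proof. by move=> t x y; apply: quatP => /=; ring. Qed.
Lemma quat_scaleDl x : {morph quat_scale^~ x : s t / s + t}.
Proof. by move=> s t; apply: quatP => /=; ring. Qed.

HB.instance Definition _ := GRing.Zmodule_isLmodule.Build R (quat R)
  quat_scaleA quat_scale1 quat_scaleDr quat_scaleDl.

Lemma quat_scaleAl t x y : t *: (x * y) = (t *: x) * y.
Proof. by apply: quatP => /=; ring. Qed.
Lemma quat_scaleAr t x y : t *: (x * y) = x * (t *: y).
Proof. by apply: quatP => /=; ring. Qed.

HB.instance Definition _ :=
  GRing.Lmodule_isLalgebra.Build R (quat R) quat_scaleAl.
HB.instance Definition _ :=
  GRing.Lalgebra_isAlgebra.Build R (quat R) quat_scaleAr.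

Definition quat_norm x : R :=
  Num.sqrt (qre x ^+ 2 + qi x ^+ 2 + qj x ^+ 2 + qk x ^+ 2).

Lemma quat_norm_sqr x :
  quat_norm x ^+ 2 = qre x ^+ 2 + qi x ^+ 2 + qj x ^+ 2 + qk x ^+ 2.
Proof. by rewrite sqr_sqrtr// !addr_ge0 ?sqr_ge0. Qed.

Lemma quat_normD x y : quat_norm (x + y) <= quat_norm x + quat_norm y.
Proof.
rewrite -(ler_pXn2r (n := 2)) ?nnegrE ?addr_ge0 ?sqrtr_ge0//.
rewrite sqrrD !quat_norm_sqr /=.
suff : qre x * qre y + qi x * qi y + qj x * qj y + qk x * qk y <=
    quat_norm x * quat_norm y by lra.
apply: le_trans (ler_norm _) _.
rewrite -(ler_pXn2r (n := 2)) ?nnegrE ?mulr_ge0 ?sqrtr_ge0//.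
rewrite real_normK ?num_real// exprMn !quat_norm_sqr -subr_ge0.
rewrite [leRHS](_ : _ =
  (qre x * qi y - qi x * qre y) ^+ 2 + (qre x * qj y - qj x * qre y) ^+ 2 +
  (qre x * qk y - qk x * qre y) ^+ 2 + (qi x * qj y - qj x * qi y) ^+ 2 +
  (qi x * qk y - qk x * qi y) ^+ 2 + (qj x * qk y - qk x * qj y) ^+ 2).
  by rewrite !addr_ge0 ?sqr_ge0.
by ring.
Qed.

Lemma quat_normZ t x : quat_norm (t *: x) = `|t| * quat_norm x.
Proof.
rewrite /quat_norm /= !exprMn -!mulrDr sqrtrM ?sqr_ge0//.
by rewrite sqrtr_sqr.
Qed.

Lemma quat_norm0_eq0 x : quat_norm x = 0 -> x = 0.
Proof.
move=> /(congr1 (fun t => t ^+ 2)); rewrite quat_norm_sqr expr0n/= => /eqP.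
rewrite !paddr_eq0 ?addr_ge0 ?sqr_ge0// !sqrf_eq0.
by move=> /andP[/andP[/andP[/eqP ? /eqP ?] /eqP ?] /eqP ?]; apply: quatP.
Qed.

(* The topology of the quaternions is the one induced by the Euclidean norm. *)
HB.instance Definition _ := Lmodule_isNormed.Build R (quat R)
  quat_normD quat_normZ quat_norm0_eq0.

End quaternions.

Section slice_regularity.
Context (R : realType).

Definition quat_ball : set (quat R) := [set q | `|q| < 1].

Definition imaginary_unit : set (quat R) := [set I | I ^+ 2 = -1].

Definition slice (I : quat R) (p : R * R) : quat R := p.1%:A + p.2 *: I.

(* Only the values of f on quat_ball matter: the coordinate disc
   slice I @^-1` quat_ball is open in R * R. *)
Definition slice_regular (f : quat R -> quat R) :=
  forall I, imaginary_unit I ->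
    let fI : R * R -> quat R := f \o slice I in
    let D := slice I @^-1` quat_ball in
    [/\ forall p, D p -> derivable fI p (1, 0) /\ derivable fI p (0, 1),
        {within D, continuous 'D_(1, 0) fI},
        {within D, continuous 'D_(0, 1) fI} &
        forall p, D p -> 2^-1 *: ('D_(1, 0) fI p + I * 'D_(0, 1) fI p) = 0].

End slice_regularity.

Definition boundary (T : topologicalType) (A : set T) : set T :=
  closure A `\` interior A.

Definition half_space (R : realType) : set (quat R) := [set q | qre q <= 1].

(* Main.v *)
(* Everything follows from [`|a m| <= 2 * (1 - Re (a 0))] for [m > 0], because
   [3^-1 + 3^-2 + ...] is [1 / 2] and the distance of [f 0] to the boundary is at
   least [1 - Re (f 0)].  On the sphere of radius [r < 1], a long partial sum of
   the series has real part at most [1 + e]; averaging it over roots of unity of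
   one slice, against a nonnegative weight, isolates the coefficients of index
   [0] and [m].  Then [e] tends to [0] and [r] to [1]. *)
Require Import Defs.
From HB Require Import structures.
From mathcomp Require Import all_boot all_order all_algebra.
From mathcomp Require Import all_classical all_reals all_analysis.
From mathcomp Require Import ring lra zify.

Import Order.TTheory GRing.Theory Num.Theory.
Import numFieldNormedType.Exports.

Local Open Scope classical_set_scope.
Local Open Scope ring_scope.

(** * Real part, norm and conjugation of quaternions *)

Lemma qreD {R : realType} (x y : quat R) : qre (x + y) = qre x + qre y.
Proof. by []. Qed.

Lemma qreB {R : realType} (x y : quat R) : qre (x - y) = qre x - qre y.
Proof. by []. Qed.

Lemma qreZ {R : realType} (t : R) (x : quat R) : qre (t *: x) = t * qre x.
Proof. by []. Qed.

Lemma qre_sum {R : realType} (I : Type) (s : seq I) (P : pred I) (F : I -> quat R) :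
  qre (\sum_(i <- s | P i) F i) = \sum_(i <- s | P i) qre (F i).
Proof. exact: (big_morph (@qre R) (@qreD R)). Qed.

Lemma qre_mulC {R : realType} (x y : quat R) : qre (x * y) = qre (y * x).
Proof. by rewrite /=; ring. Qed.

Lemma quat_norm_sqrE {R : realType} (x : quat R) :
  `|x| ^+ 2 = qre x ^+ 2 + qi x ^+ 2 + qj x ^+ 2 + qk x ^+ 2.
Proof. exact: quat_norm_sqr. Qed.

Lemma quat_normM {R : realType} (x y : quat R) : `|x * y| = `|x| * `|y|.
Proof.
apply/eqP; rewrite -(@eqrXn2 _ 2) ?mulr_ge0//; apply/eqP.
by rewrite exprMn !quat_norm_sqrE /=; ring.
Qed.

Lemma quat_norm1 {R : realType} : `|1 : quat R| = 1.
Proof.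
apply/eqP; rewrite -(@eqrXn2 _ 2)//; apply/eqP.
by rewrite quat_norm_sqrE /=; ring.
Qed.

Lemma quat_normX {R : realType} (x : quat R) n : `|x ^+ n| = `|x| ^+ n.
Proof.
by elim: n => [|n IHn]; rewrite ?expr0 ?quat_norm1// !exprS quat_normM IHn.
Qed.

Lemma ler_norm_qre {R : realType} (x : quat R) : `|qre x| <= `|x|.
Proof.
rewrite -(ler_pXn2r (n := 2)) ?nnegrE//.
by rewrite real_normK ?num_real// quat_norm_sqrE -!addrA lerDl !addr_ge0 ?sqr_ge0.
Qed.

Lemma quat_mulf_eq0 {R : realType} (x y : quat R) :
  (x * y == 0) = (x == 0) || (y == 0).
Proof. by rewrite -normr_eq0 quat_normM mulf_eq0 !normr_eq0. Qed.

Definition quat_conj {R : realType} (x : quat R) : quat R :=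
  Quat (qre x) (- qi x) (- qj x) (- qk x).

Lemma quat_conjM {R : realType} (x y : quat R) :
  quat_conj (x * y) = quat_conj y * quat_conj x.
Proof. by apply: quatP => /=; ring. Qed.

Lemma quat_conjX {R : realType} (x : quat R) n :
  quat_conj (x ^+ n) = quat_conj x ^+ n.
Proof.
elim: n => [|n IHn]; first by apply: quatP => //=; exact: oppr0.
by rewrite exprS exprSr quat_conjM IHn.
Qed.

Lemma quat_mul_conj {R : realType} (x : quat R) : x * quat_conj x = (`|x| ^+ 2)%:A.
Proof. by rewrite quat_norm_sqrE; apply: quatP => /=; ring. Qed.

(** Linearises a product of real parts, as the product formula for cosines does, so that sums over
    roots of unity apply to it. *)
Lemma qre_mul_qre {R : realType} (x y : quat R) :
  qre x * qre y = 2^-1 * qre (x * y + quat_conj x * y).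
Proof. by rewrite /=; field. Qed.

(** * Imaginary units and roots of unity in a slice *)

Lemma quat_polar {R : realType} (b : quat R) :
  exists2 e : quat R, `|e| = 1 & b = `|b| *: e.
Proof.
have [->|b0] := eqVneq b 0.
  by exists 1; rewrite ?quat_norm1// normr0 scale0r.
exists (`|b|^-1 *: b); last by rewrite scalerA divff ?normr_eq0// scale1r.
by rewrite normrZ normfV normr_id mulVf// normr_eq0.
Qed.

(** The normalised vector part of [e] serves as [I]; when [e] is real, every imaginary unit does. *)
Lemma imaginary_unit_comm {R : realType} (e : quat R) :
  exists2 I, imaginary_unit I & I * e = e * I.
Proof.
pose v : quat R := Quat 0 (qi e) (qj e) (qk e).
have [v0|v0] := eqVneq v 0.
  case: v0 => i0 j0 k0; exists (Quat 0 1 0 0).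
    by rewrite /imaginary_unit/= expr2; apply: quatP => /=; ring.
  by apply: quatP => /=; rewrite i0 j0 k0; ring.
have [u nu vE] := quat_polar v.
have nv0 : `|v| != 0 by rewrite normr_eq0.
have u0 : qre u = 0.
  by apply/eqP; have /(congr1 (@qre R))/= /esym/eqP := vE; rewrite mulf_eq0 (negPf nv0).
exists u.
  have := quat_norm_sqrE u; rewrite nu u0 expr1n => h.
  rewrite /imaginary_unit/= expr2; apply: quatP => /=; rewrite ?u0; try ring.
  by rewrite [X in _ = - X]h; ring.
have -> : e = (qre e)%:A + v by apply: quatP => /=; ring.
rewrite mulrDr mulrDl -scalerAr -scalerAl mulr1 mul1r; congr (_ + _).
by rewrite vE -scalerAr -scalerAl.
Qed.

(** De Moivre's formula in the plane of [I]. *)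
Lemma slice_cos_sinX {R : realType} (I : quat R) (t : R) n :
  imaginary_unit I ->
  slice I (cos t, sin t) ^+ n = slice I (cos (t *+ n), sin (t *+ n)).
Proof.
rewrite /imaginary_unit/= expr2 => I2; elim: n => [|n IHn].
  by rewrite expr0 mulr0n cos0 sin0 /slice/= scale1r scale0r addr0.
rewrite exprS IHn mulrS cosD sinD /slice/= mulrDl !mulrDr.
rewrite -!scalerAl -!scalerAr !mul1r mulr1 I2 !scalerA scalerN scalerBl !scalerDl.
have -> : sin t * cos (t *+ n) = cos (t *+ n) * sin t by ring.
rewrite [(cos (t *+ n) * sin t) *: I - _]addrC addrACA; congr (_ + _).
exact: addrC.
Qed.

(** The vector part of the square of [I] is twice [qre I] times that of [I]. If [qre I] were
    nonzero, [I] would be real, with a nonnegative square. *)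
Lemma qre_imaginary_unit {R : realType} (I : quat R) : imaginary_unit I -> qre I = 0.
Proof.
rewrite /imaginary_unit/= expr2 => -[re_eq i_eq j_eq k_eq].
have [//|re0] := eqVneq (qre I) 0.
have im0 x : qre I * x = 0 -> x = 0.
  by move=> /eqP; rewrite mulf_eq0 (negPf re0) => /eqP.
have i0 : qi I = 0 by apply: im0; lra.
have j0 : qj I = 0 by apply: im0; lra.
have k0 : qk I = 0 by apply: im0; lra.
by have := sqr_ge0 (qre I); rewrite i0 j0 k0 in re_eq; rewrite expr2; lra.
Qed.

(** For [0 < i < N], the [i]-th power has real part [1 - 2 sin(pi i / N)^2], which is less than 1
    because the sine is positive on [(0, pi)]. *)
Lemma slice_primitive_root {R : realType} (I : quat R) N :
  imaginary_unit I -> (0 < N)%N ->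
  N.-primitive_root (slice I (cos (pi *+ 2 / N%:R), sin (pi *+ 2 / N%:R))).
Proof.
move=> I2 N0; have N0' : N%:R != 0 :> R by rewrite pnatr_eq0 -lt0n.
apply/andP; split=> //; apply/forallP => -[i iN] /=.
rewrite unity_rootE slice_cos_sinX//; set t : R := (_ *+ i.+1).
have tE : t = (pi * (i.+1%:R / N%:R)) *+ 2.
  by rewrite /t -[LHS]mulr_natr -[RHS]mulr_natr -[pi *+ 2]mulr_natr; field.
have [iN1|iN1] := eqVneq i.+1 N.
  have -> : t = pi *+ 2 by rewrite tE iN1 divff// mulr1.
  by rewrite cos2pi sin2pi /slice/= scale0r addr0 scale1r !eqxx.
apply/eqP/negbTE/eqP => /(congr1 (@qre R)).
rewrite /slice/= qre_imaginary_unit// mulr0 addr0 mulr1 tE cos_mulr2n cos2sin2.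
have iN2 : (i.+1 < N)%N by rewrite ltn_neqAle iN1.
have : 0 < sin (pi * (i.+1%:R / N%:R)) :> R.
  apply: sin_gt0_pi; rewrite mulr_gt0 ?pi_gt0 ?divr_gt0 ?ltr0n//=.
  by rewrite gtr_pMr ?pi_gt0// ltr_pdivrMr ?ltr0n// mul1r ltr_nat.
move=> /[dup] s0 /(mulr_gt0 s0); rewrite -expr2; lra.
Qed.

(** * Averaging over roots of unity *)

Lemma quat_unity_root_norm {R : realType} (w : quat R) N :
  (0 < N)%N -> w ^+ N = 1 -> `|w| = 1.
Proof.
move=> N0 wN; apply/eqP; rewrite -(@pexpr_eq1 _ _ N)// -quat_normX wN.
by rewrite quat_norm1.
Qed.

(** If [N] does not divide [j], the nonzero factor [w ^+ j - 1] annihilates the geometric sum, and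
    quaternions have no zero divisors. *)
Lemma sum_prim_root_expr {R : realType} (w : quat R) N j :
  N.-primitive_root w ->
  \sum_(k < N) w ^+ (k * j) = if (N %| j)%N then N%:R else 0.
Proof.
move=> wP; have wN := prim_expr_order wP.
have -> : \sum_(k < N) w ^+ (k * j) = \sum_(k < N) (w ^+ j) ^+ k.
  by apply: eq_bigr => k _; rewrite mulnC exprM.
case: ifPn => Nj.
  rewrite (eq_bigr (fun=> 1)) ?sumr_const ?card_ord// => k _.
  by rewrite (eqP (_ : w ^+ j == 1)) ?expr1n// -(prim_order_dvd wP).
have : (w ^+ j - 1) * \sum_(k < N) (w ^+ j) ^+ k == 0.
  by rewrite -subrX1 -exprM mulnC exprM wN expr1n subrr.
by rewrite quat_mulf_eq0 subr_eq0 -(prim_order_dvd wP) (negPf Nj) => /eqP.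
Qed.

(* The average over the [2M]-th roots of unity [w ^+ k] of the product of
   [C - qre (\sum_n (w ^+ k) ^+ n * c n)] and [1 + qre (w ^+ (k * m) * e)], both
   nonnegative, is [C - qre (c 0) - `|c m| / 2] when [c m = `|c m| *: e].
   Choosing [w] in a slice that contains [e] makes [e] commute with the powers
   of [w]. *)
Lemma qre_poly_coef_le {R : realType} (c : nat -> quat R) (M m : nat) (C : R) :
  (0 < m < M)%N ->
  (forall u : quat R, `|u| = 1 -> qre (\sum_(n < M) u ^+ n * c n) <= C) ->
  `|c m| <= 2 * (C - qre (c 0%N)).
Proof.
move=> /andP[m0 mM] P_le; have [e ne cmE] := quat_polar (c m).
have [I I2 Ie] := imaginary_unit_comm e.
(* With [n, m < M], order [2M] leaves no aliasing: [n + m] is never 0 modulo [N], and [n - m] is so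
   only for [n = m]. *)
pose N := M.*2; have M0 : (0 < M)%N by exact: leq_ltn_trans mM.
have N0 : (0 < N)%N by rewrite double_gt0.
have wP := slice_primitive_root I N I2 N0; set w := slice _ _ in wP.
have wN := prim_expr_order wP; have nw := quat_unity_root_norm w N N0 wN.
have we k : w ^+ k * e = e * w ^+ k.
  apply/esym/commrX.
  rewrite /GRing.comm /w /slice/= [LHS]mulrDr [RHS]mulrDl -!scalerAl -!scalerAr.
  by rewrite mul1r mulr1 Ie.
(* Conjugation inverts [w]; writing the exponent [- m] as [N - m] keeps it a natural number. *)
have wC k : quat_conj w ^+ (k * m) = w ^+ (k * (N - m)).
  have mN : (m <= N)%N by rewrite /N -addnn (leq_trans (ltnW mM))// leq_addr.
  have wwC : w ^+ (k * m) * quat_conj w ^+ (k * m) = 1.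
    by rewrite -quat_conjX quat_mul_conj quat_normX nw !expr1n scale1r.
  rewrite -[RHS]mulr1 -wwC mulrA -exprD -mulnDr subnK// [(k * N)%N]mulnC.
  rewrite [X in X * _]exprM wN.
  by rewrite expr1n mul1r.
pose P k := qre (\sum_(n < M) (w ^+ k) ^+ n * c n).
pose W k := qre (w ^+ (k * m) * e).
have pos k : 0 <= (C - P k) * (1 + W k).
  rewrite mulr_ge0// ?subr_ge0 ?P_le ?quat_normX ?nw ?expr1n//.
  have := ler_norm_qre (w ^+ (k * m) * e).
  rewrite quat_normM quat_normX nw ne expr1n mulr1 ler_norml => /andP[+ _].
  by rewrite /W; lra.
have sumW : \sum_(k < N) W k = 0.
  rewrite /W -qre_sum -mulr_suml sum_prim_root_expr// gtnNdvd ?mul0r//.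
  by rewrite /N -addnn ltn_addr.
have sumP : \sum_(k < N) P k = N%:R * qre (c 0%N).
  rewrite /P -qre_sum -qreZ; congr qre.
  rewrite exchange_big/= (bigD1 (Ordinal M0))//= [X in _ + X]big1.
    under eq_bigr do rewrite expr0 mul1r.
    by rewrite sumr_const card_ord addr0 scaler_nat.
  move=> n n0; under eq_bigr do rewrite -exprM.
  rewrite -mulr_suml sum_prim_root_expr// gtnNdvd ?mul0r// ?lt0n//.
  by rewrite /N -addnn ltn_addr.
have sumPW : \sum_(k < N) P k * W k = N%:R * (`|c m| / 2).
  (* The weight splits into a factor with [e] and one with its conjugate, which shift the frequency
     [n] to [n + m] and to [n - m]. The order of factors leaves [e] outside the powers of [w]. *)
  have PW k : P k * W k = 2^-1 * qre (\sum_(n < M)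
      (e * w ^+ (k * (n + m)) * c n + quat_conj e * w ^+ (k * (n + (N - m))) * c n)).
    rewrite mulrC qre_mul_qre; congr (_ * qre _).
    rewrite quat_conjM quat_conjX wC we big_split/= !mulr_sumr.
    congr (_ + _); apply: eq_bigr => n _.
      by rewrite mulrA; congr (_ * _); rewrite -mulrA -exprM -exprD -mulnDr addnC.
    by rewrite mulrA; congr (_ * _); rewrite -mulrA -exprM -exprD -mulnDr addnC.
  under eq_bigr do rewrite PW.
  rewrite -mulr_sumr -qre_sum exchange_big/=.
  have dvdD (n : 'I_M) : (N %| n + m)%N = false.
    by rewrite gtnNdvd ?addn_gt0 ?m0 ?orbT// /N -addnn -addSn leq_add// ltnW.
  have dvdB (n : 'I_M) : (N %| n + (N - m))%N = (n == Ordinal mM).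
    have mN : (m < N)%N by rewrite /N -addnn ltn_addr.
    rewrite -val_eqE/=; have [nm|mn|->] := ltngtP n m.
    - by rewrite gtnNdvd//; lia.
    - rewrite (_ : (n + (N - m) = N + (n - m))%N); last lia.
      rewrite dvdn_addr// gtnNdvd// ?subn_gt0// (leq_ltn_trans (leq_subr _ _))//.
      by rewrite /N -addnn ltn_addr.
    - by rewrite subnKC ?dvdnn// ltnW.
  (* Only [n = m] in the conjugate half survives. There [quat_conj e * c m] has real part [|c m|],
     by the choice of [e]. *)
  transitivity (2^-1 * qre (N%:R *: (quat_conj e * c m))).
    congr (_ * qre _); rewrite (bigD1 (Ordinal mM))//= [X in _ + X]big1.
      rewrite big_split/= -!mulr_suml -!mulr_sumr !sum_prim_root_expr//.
      rewrite (dvdD (Ordinal mM)) (dvdB (Ordinal mM)) eqxx.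
      by rewrite mulr0 mul0r add0r addr0 -scaler_nat -scalerAr mulr1 scalerAl.
    move=> n nm.
    rewrite big_split/= -!mulr_suml -!mulr_sumr !sum_prim_root_expr// dvdD dvdB.
    by rewrite (negPf nm) !mulr0 !mul0r addr0.
  rewrite qreZ [in LHS]cmE -[_ * (_ *: e)]scalerAr qreZ qre_mulC quat_mul_conj ne expr1n.
  by rewrite scale1r /=; field.
have : 0 <= \sum_(k < N) (C - P k) * (1 + W k) by apply: sumr_ge0.
under eq_bigr => k _ do rewrite mulrDr mulr1 mulrBl.
rewrite big_split/= !sumrB -mulr_sumr sumW sumP sumPW sumr_const card_ord.
rewrite -[C *+ _]mulr_natl (_ : _ + _ = N%:R * (C - qre (c 0%N) - `|c m| / 2)); last ring.
rewrite pmulr_rge0 ?ltr0n//; lra.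
Qed.

(** * Absolute convergence and tails of the power series *)

Lemma quat_normA {R : realType} (r : R) : `|r%:A : quat R| = `|r|.
Proof. by rewrite normrZ quat_norm1 mulr1. Qed.

(** Abel's argument: the terms at radius [s] are bounded, so those at [r] are dominated by a
    geometric series of ratio [r / s]. *)
Lemma quat_norm_series_cvg {R : realType} (a : nat -> quat R) (s r : R) :
  0 <= r < s -> cvgn (series (fun n => s%:A ^+ n * a n)) ->
  cvgn (series (fun n => r ^+ n * `|a n|)).
Proof.
move=> /andP[r0 rs] /cvg_series_cvg_0 /cvgP /cvg_seq_bounded.
move=> [K0 [_ /(_ (K0 + 1))]]; rewrite ltrDl ltr01 => /(_ isT).
move: (K0 + 1) => K Ka.
have s0 : 0 < s := le_lt_trans r0 rs.
apply: (@series_le_cvg _ _ (geometric K (r / s))) => [n|n|n|].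
- by rewrite mulr_ge0// exprn_ge0.
- by rewrite mulr_ge0 ?exprn_ge0 ?divr_ge0 ?(ltW s0)// (le_trans _ (Ka 0%N I)).
- have := Ka n I; rewrite /= quat_normM quat_normX quat_normA gtr0_norm// => Kn.
  rewrite /= expr_div_n mulrCA ler_wpM2l ?exprn_ge0//.
  by rewrite ler_pdivlMr ?exprn_gt0// mulrC.
- apply: is_cvg_geometric_series.
  by rewrite ger0_norm ?divr_ge0 ?(ltW s0)// ltr_pdivrMr// mul1r.
Qed.

(** The majorant depends on [q] only through its norm, so one [M0] serves the whole sphere, as a
    bound on a fixed polynomial requires. *)
Lemma quat_series_tail {R : realType} (a : nat -> quat R) (r e : R) :
  0 <= r -> 0 < e -> cvgn (series (fun n => r ^+ n * `|a n|)) ->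
  exists M0, forall M, (M0 <= M)%N -> forall q : quat R, `|q| = r ->
    forall M', (M <= M')%N ->
    `|series (fun n => q ^+ n * a n) M' - series (fun n => q ^+ n * a n) M| <= e.
Proof.
move=> r0 e0 /cauchy_cvgP/cauchy_seriesP/(_ e e0)[[A B]] /= [[N1 _ N1A] [N2 _ N2B]] AB.
exists (maxn N1 N2) => M; rewrite geq_max => /andP[N1M N2M] q qr M' MM'.
rewrite sub_series_geq//; apply: le_trans (ler_norm_sum _ _ _) _.
have := AB (M, M') (conj (N1A _ N1M) (N2B _ (leq_trans N2M MM'))).
move=> /ltW; apply: le_trans; apply: le_trans (ler_norm _).
by apply: ler_sum => n _; rewrite quat_normM quat_normX qr.
Qed.

Lemma quat_powerseries0 {R : realType} (a : nat -> quat R) :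
  series (fun n => 0 ^+ n * a n) @ \oo --> a 0%N.
Proof.
apply: cvg_near_cst; near=> n.
have n0 : (0 < n)%N by near: n; exact: nbhs_infty_gt.
rewrite /series/= -(prednK n0) big_nat_recl// expr0 mul1r big1 ?addr0// => i _.
by rewrite exprS mul0r mul0r.
Unshelve. all: by end_near. Qed.

(** * The coefficient bound *)

Lemma half_space_coef_le {R : realType} (f : quat R -> quat R) (a : nat -> quat R)
  (f_series : forall q : quat R, quat_ball q ->
     series (fun n => q ^+ n * a n) @ \oo --> f q)
  (f_half_space : forall q : quat R, quat_ball q -> half_space (f q)) m :
  (0 < m)%N -> `|a m| <= 2 * (1 - qre (a 0%N)).
Proof.
move=> m0.
have le_r (r : R) : 0 <= r < 1 -> r ^+ m * `|a m| <= 2 * (1 - qre (a 0%N)).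
  move=> /andP[r0 r1]; apply/ler_addgt0Pr => e e0.
  (* A radius strictly between [r] and 1: convergence at [s] gives absolute convergence at [r]. *)
  pose s := (r + 1) / 2.
  have [s0 rs s1] : [/\ 0 <= s, r < s & s < 1] by rewrite /s; split; lra.
  have cvg_s : cvgn (series (fun n => s%:A ^+ n * a n)).
    by apply/cvg_ex; eexists; apply: f_series; rewrite /quat_ball/= quat_normA ger0_norm.
  (* One [e / 4] pays for the tail and one for the limit; the factor 2 in the polynomial bound turns
     their sum [e / 2] into [e]. *)
  have e4 : 0 < e / 4 by rewrite divr_gt0.
  have [|M0 M0P] := quat_series_tail a r (e / 4) r0 e4.
    by apply: quat_norm_series_cvg cvg_s; rewrite r0.
  pose M := maxn M0 m.+1.
  have := qre_poly_coef_le (fun n => r ^+ n *: a n) M m (1 + e / 2).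
  rewrite expr0 scale1r normrZ ger0_norm ?exprn_ge0// m0 leq_maxr => /(_ isT) h.
  suff /h : forall u : quat R, `|u| = 1 ->
    qre (\sum_(n < M) u ^+ n * (r ^+ n *: a n)) <= 1 + e / 2 by lra.
  move=> u u1; pose q := r *: u.
  have qr : `|q| = r by rewrite normrZ u1 mulr1 ger0_norm.
  have qB : quat_ball q by rewrite /quat_ball/= qr.
  rewrite (_ : \sum_(n < M) _ = series (fun n => q ^+ n * a n) M); last first.
    rewrite /series/= big_mkord; apply: eq_bigr => n _.
    by rewrite /= exprZn -scalerAl -scalerAr.
  have /cvgrPdist_lt/(_ _ e4)[M1 _ M1P] := f_series q qB.
  have := M1P (maxn M M1) (leq_maxr _ _).
  have := M0P M (leq_maxl _ _) q qr (maxn M M1) (leq_maxl _ _).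
  have := f_half_space q qB; rewrite /half_space/=.
  move: (series _ _) (series _ _) => x y f1 xy fx.
  have := le_trans (ler_norm_qre _) xy; have := le_lt_trans (ler_norm_qre _) fx.
  by rewrite !qreB ltr_norml ler_norml => /andP[? _] /andP[? _]; lra.
(* The bound is known only for [r < 1], hence a limit from the left. *)
have cvg1 : (fun r : R => r ^+ m * `|a m|) @ (1 : R)^'- --> 1 ^+ m * `|a m|.
  apply: cvg_at_left_filter; apply: cvgM; last exact: cvg_cst.
  exact: exprn_continuous.
rewrite -[leLHS]mul1r -[X in X * _](expr1n _ m) -(cvg_lim _ cvg1)//.
apply: limr_le; first by apply/cvg_ex; eexists; exact: cvg1.
near=> r; apply: le_r; apply/andP; split; near: r; last exact: nbhs_left_lt.
exact: nbhs_left_ge.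
Unshelve. all: by end_near. Qed.

(** * Distance to the boundary of the half-space *)

Lemma boundary_half_space_ge1 {R : realType} (y : quat R) :
  boundary (@half_space R) y -> 1 <= qre y.
Proof.
move=> [_ yI]; rewrite leNgt; apply/negP => y1; apply: yI.
(* If [qre y < 1], the ball of this radius stays in the half-space, so [y] would be interior. *)
apply/nbhs_ballP; exists (1 - qre y); first by rewrite /= subr_gt0.
move=> z; rewrite -ball_normE/= => yz.
have := le_lt_trans (ler_norm_qre _) yz.
by rewrite qreB ltr_norml /half_space/= => /andP[? _]; lra.
Qed.

(** [edist_inf] is an infimum over boundary points of infima over radii; each admissible radius
    exceeds the gap between the real parts. *)
Lemma edist_inf_half_space_ge {R : realType} (x : quat R) :
  ((1 - qre x)%:E <= edist_inf (boundary (@half_space R)) x)%E.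
Proof.
apply: le_ereal_inf_tmp => _ [y /boundary_half_space_ge1 y1 <-].
apply: le_ereal_inf_tmp => _ [r [r0 /=]] + <-.
rewrite -ball_normE/= lee_fin => /(le_lt_trans (ler_norm_qre _)).
by rewrite qreB ltr_norml => /andP[? _]; lra.
Qed.

Theorem theorem6p1 (R : realType) (f : quat R -> quat R) (a : nat -> quat R)
  (f_regular : slice_regular f)
  (f_series : forall q : quat R, quat_ball q ->
     series (fun n => q ^+ n * a n) @ \oo --> f q)
  (f_half_space : forall q : quat R, quat_ball q -> half_space (f q))
  (q : quat R) (q_small : `|q| <= 3^-1) :
  (\sum_(1 <= n <oo) (`|q ^+ n * a n|)%:E
     <= edist_inf (boundary (@half_space R)) (f 0%R))%E.
Proof.
apply: le_trans (edist_inf_half_space_ge _).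
have B0 : quat_ball (0 : quat R) by rewrite /quat_ball/= normr0.
have -> : f 0 = a 0%N.
  by apply: (cvg_unique _ (f_series 0 B0) (quat_powerseries0 a)).
set d := 1 - _.
apply: lime_le; first by apply: is_cvg_nneseries => n _ _; rewrite lee_fin.
apply: nearW => M; rewrite sumEFin lee_fin.
(* The coefficient bound at index 1 already forces [d] to be nonnegative. *)
have d0 : 0 <= d.
  have := half_space_coef_le f a f_series f_half_space 1 isT.
  by move=> /(le_trans (normr_ge0 _)); rewrite -/d; lra.
(* At radius 1/3 the powers of index at least 1 sum to 1/2, which exactly cancels the factor 2 of
   the coefficient bound. *)
have geom : forall N, \sum_(1 <= n < N.+1) 2 * d * 3^-1 ^+ n = d * (1 - 3^-1 ^+ N).
  elim=> [|N IHN]; first by rewrite big_geq// expr0 subrr mulr0.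
  by rewrite big_nat_recr//= IHN exprS; field.
case: M => [|M]; first by rewrite big_geq.
apply: (@le_trans _ _ (\sum_(1 <= n < M.+1) 2 * d * 3^-1 ^+ n)).
  rewrite !big_nat; apply: ler_sum => n /andP[n1 _].
  rewrite quat_normM quat_normX mulrC ler_pM ?exprn_ge0//.
    exact: half_space_coef_le f_series f_half_space _ n1.
  by rewrite lerXn2r// nnegrE.
by rewrite geom ler_piMr// gerBl exprn_ge0.
Qed.
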